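(* Let $f:\mathbb{R}^{n+1}\to\mathbb{R}$ be $C^3$ and let $x^\star$ be a nondegenerate minimizer, i.e. $\nabla f(x^\star)=0$ and $H_\star:=\nabla^2f(x^\star)\succ0$. Suppose there is a neighborhood $\mathcal{U}$ of $x^\star$ in which the affine-normal direction $d_{\mathrm{AN}}(x)$ of the level set $\{f=f(x)\}$ is well defined for all $x\in\mathcal{U}$ and all third derivatives of $f$ are bounded. Suppose the affine-normal descent direction $d_k$ at $x_k$ admits the decomposition $$d_k=d_{\mathrm{N}}(x_k)+\Delta_k,\qquad d_{\mathrm{N}}(x_k):=-\nabla^2f(x_k)^{-1}\nabla f(x_k),$$ and satisfies $$\|d_{\mathrm{N}}(x_k)\|=O(\|x_k-x^\star\|),\qquad\|\Delta_k\|=O(\|x_k-x^\star\|^2).$$ Consider the line-search iteration $x_{k+1}=x_k+\alpha_kd_k$, where the step sizes obey $$\alpha_k\to1\quad\text{and}\quad|\alpha_k-1|\le C_\alpha\|x_k-x^\star\|\quad\text{for all }k\text{ sufficiently large}$$ for some constant $C_\alpha$. Then there exists a constant $C>0$ such that, for all $k$ sufficiently large, $$\|x_{k+1}-x^\star\|\le C\|x_k-x^\star\|^2.$$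
   Context: Affine normal. At $x$ with $\nabla f(x)\ne0$ put $e_{n+1}=\nabla f(x)/\|\nabla f(x)\|$ and let $e_1,\dots,e_n$ be an orthonormal basis of $\nabla f(x)^\perp$. With $f_{ij}=D^2f(x)[e_i,e_j]$, $f_{n+1,i}=D^2f(x)[e_{n+1},e_i]$, $f_{pqi}=D^3f(x)[e_p,e_q,e_i]$ ($i,j,p,q\le n$) and $(f^{ij})$ the inverse of $(f_{ij})_{i,j\le n}$, the affine normal direction is, up to a nonzero scalar, $d_{\mathrm{AN}}(x)\propto\sum_i\big(\sum_jf^{ij}(-\frac1{n+2}\|\nabla f(x)\|\sum_{p,q}f^{pq}f_{pqj}+f_{n+1,j})\big)e_i-e_{n+1}$; at $x^\star$ it is understood as $0$. The affine-normal descent direction $d_k$ is a representative (the scale is not fixed) equal to $d_{\mathrm{AN}}(x_k)$ if $\langle\nabla f(x_k),d_{\mathrm{AN}}(x_k)\rangle<0$, to $-d_{\mathrm{AN}}(x_k)$ if this inner product is $>0$, and to $-\nabla f(x_k)/\|\nabla f(x_k)\|$ otherwise. The $O(\cdot)$ bounds are with constants independent of $k$, for all $k$ sufficiently large. *)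

(* Defs.v *)
From HB Require Import structures.
From mathcomp Require Import all_boot all_order all_algebra.
From mathcomp Require Import all_classical all_reals all_analysis.

Set Implicit Arguments.
Unset Strict Implicit.
Unset Printing Implicit Defensive.

Import Order.TTheory GRing.Theory Num.Theory.
Import numFieldNormedType.Exports.

Local Open Scope classical_set_scope.
Local Open Scope ring_scope.

Section Euclidean.
Variables (R : realType) (m : nat).
Implicit Types u v : 'cV[R]_m.

Definition dot u v : R := \sum_i u i 0 * v i 0.

(* The library norm `|u| on matrices is the sup norm. *)
Definition enorm u : R := Num.sqrt (dot u u).

Definition ebasis (i : 'I_m) : 'cV[R]_m := delta_mx i 0.

(* Used only for Hessians of C^3 functions, whose symmetry is automatic. *)
Definition posdef (A : 'M[R]_m) : Prop :=
  forall v, v != 0 -> 0 < dot v (A *m v).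

End Euclidean.

Section Derivatives.
Variables (R : realType) (n : nat).
Implicit Types (f : 'cV[R]_n.+1 -> R) (x u v w : 'cV[R]_n.+1).

(* In finite dimension, Df is of class C^k iff all the maps x |-> Df(x)[v]
   are. *)
Fixpoint class_C (k : nat) f : Prop :=
  if k is k'.+1 then
    (forall x, differentiable f x) /\
    (forall v, class_C k' (fun x => 'D_v f x))
  else continuous f.

Definition D2 f x u v : R := 'D_u (fun y => 'D_v f y) x.

Definition D3 f x u v w : R := 'D_u (fun y => D2 f y v w) x.

Definition grad f x : 'cV[R]_n.+1 := \col_i 'D_(ebasis R i) f x.

Definition hess f x : 'M[R]_n.+1 :=
  \matrix_(i, j) D2 f x (ebasis R i) (ebasis R j).

Definition newton f x : 'cV[R]_n.+1 := - (invmx (hess f x) *m grad f x).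

End Derivatives.

Section AffineNormal.
Variables (R : realType) (n : nat).
Implicit Types (f : 'cV[R]_n.+1 -> R) (x v d : 'cV[R]_n.+1).
Implicit Types (e : 'I_n -> 'cV[R]_n.+1).

Definition unit_normal f x : 'cV[R]_n.+1 := (enorm (grad f x))^-1 *: grad f x.

(* A family of n orthonormal vectors orthogonal to grad f x is a basis of the
   orthogonal complement of grad f x as soon as grad f x != 0. *)
Definition tangent_frame f x e : Prop :=
  (forall i j, dot (e i) (e j) = (i == j)%:R) /\
  (forall i, dot (e i) (grad f x) = 0).

Definition tangent_hess f x e : 'M[R]_n := \matrix_(i, j) D2 f x (e i) (e j).

Definition affine_normal_formula f x e : 'cV[R]_n.+1 :=
  let F' := invmx (tangent_hess f x e) in
  let b j :=
    - ((n + 2)%:R^-1 * enorm (grad f x) *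
         \sum_p \sum_q F' p q * D3 f x (e p) (e q) (e j))
    + D2 f x (unit_normal f x) (e j) in
  \sum_i (\sum_j F' i j * b j) *: e i - unit_normal f x.

(* The direction is only determined up to a nonzero scalar, hence a relation;
   no v satisfies it at x != xstar when the direction is not well defined,
   that is when x is critical or the tangential Hessian is singular. *)
Definition is_affine_normal f (xstar x v : 'cV[R]_n.+1) : Prop :=
  (x = xstar /\ v = 0) \/
  [/\ x <> xstar, grad f x != 0 &
      exists e, [/\ tangent_frame f x e, tangent_hess f x e \in unitmx &
        exists2 c : R, c != 0 & v = c *: affine_normal_formula f x e]].

(* At x = xstar the last case applies, and yields d = 0 because
   unit_normal f xstar = 0^-1 *: 0 = 0 when grad f xstar = 0. *)
Definition is_affine_normal_descent f (xstar x d : 'cV[R]_n.+1) : Prop :=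
  [\/ exists v, [/\ is_affine_normal f xstar x v, dot (grad f x) v < 0 & d = v],
      exists v, [/\ is_affine_normal f xstar x v, 0 < dot (grad f x) v
                  & d = - v]
    | (forall v, is_affine_normal f xstar x v -> dot (grad f x) v = 0) /\
      d = - unit_normal f x].

End AffineNormal.

(* Main.v *)
(* Taylor's formula gives hess f x *m (x - xstar) - grad f x = O(|x - xstar|^2),
   the Hessian being Lipschitz because third derivatives are bounded; since
   hess f xstar is invertible and a small perturbation of it stays uniformly
   invertible, an exact Newton step squares the error near xstar.  Replacing it
   by alpha_k d_k changes the new iterate by
   (alpha_k - 1) newton + alpha_k Delta_k = O(|x - xstar|^2). *)
Require Import Defs.
From HB Require Import structures.
From mathcomp Require Import all_boot all_order all_algebra.
From mathcomp Require Import all_classical all_reals all_analysis.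
From mathcomp Require Import ring lra.

Set Implicit Arguments.
Unset Strict Implicit.
Unset Printing Implicit Defensive.

Import Order.TTheory GRing.Theory Num.Theory.
Import numFieldNormedType.Exports.

Local Open Scope classical_set_scope.
Local Open Scope ring_scope.

(** * Mean values along lines and symmetry of second derivatives *)

Section DirectionalDerivatives.
Variables (R : realType) (V : normedModType R).
Implicit Types (f : V -> R) (a x u v : V).

Lemma is_derive_line f a v (t : R) :
  differentiable f (a + t *: v) ->
  is_derive t (1 : R) (fun s => f (a + s *: v)) ('D_v f (a + t *: v)).
Proof.
move=> df.
have E : (fun h : R => h^-1 *: (((fun s => f (a + s *: v)) \o shift t) (h *: 1)
            - f (a + t *: v))) =
         (fun h : R => h^-1 *: ((f \o shift (a + t *: v)) (h *: v)
            - f (a + t *: v))).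
  by apply/funext => h /=; rewrite scaler1 scalerDl addrCA.
split; first by rewrite /derivable E; exact: diff_derivable.
by rewrite /derive E.
Qed.

Lemma MVT_line f v (h : R) x : (forall y, differentiable f y) -> 0 <= h ->
  exists2 c : R, 0 <= c <= h & f (x + h *: v) - f x = h * 'D_v f (x + c *: v).
Proof.
move=> df h0.
have [|c c_h E] := MVT_segment h0 (fun t _ => is_derive_line (df (x + t *: v))).
  apply: derivable_within_continuous => t _.
  exact: (@ex_derive _ _ _ _ _ _ _ (is_derive_line (df (x + t *: v)))).
exists c; first by rewrite in_itv in c_h.
by move: E; rewrite scale0r addr0 subr0 mulrC.
Qed.

(** The mean value theorem is applied to [f (x + h *: v + s *: u) - f (x + s *: u)] as a function of
    [s], then to ['D_u f] in direction [v]. *)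
Lemma second_difference f u v x (h : R) :
  (forall y, differentiable f y) -> (forall y, differentiable ('D_u f) y) ->
  0 <= h ->
  exists c : R * R, [/\ 0 <= c.1 <= h, 0 <= c.2 <= h &
    f (x + h *: u + h *: v) - f (x + h *: u) - f (x + h *: v) + f x
      = h * (h * 'D_v ('D_u f) (x + c.1 *: u + c.2 *: v))].
Proof.
move=> df dfu h0.
pose dphi s := is_deriveB (is_derive_line (df (x + h *: v + s *: u)))
                          (is_derive_line (df (x + s *: u))).
have [|c c_h E] := MVT_segment h0 (fun s _ => dphi s).
  apply: derivable_within_continuous => s _.
  exact: (@ex_derive _ _ _ _ _ _ _ (dphi s)).
have {}c_h : 0 <= c <= h by rewrite in_itv in c_h.
have [c' ch' E'] := MVT_line v (x + c *: u) dfu h0.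
exists (c, c'); split => //=.
move: E; rewrite !fctE scale0r !addr0 subr0 (addrAC _ (h *: v) (c *: u)) E'.
by rewrite (addrAC _ (h *: v)) [RHS]mulrC => <-; rewrite opprB addrA addrAC.
Qed.

(* Both sides are limits of the same second difference divided by h ^ 2. *)
Lemma derive_symmetric f u v x :
  (forall y, differentiable f y) ->
  (forall y, differentiable ('D_u f) y) ->
  (forall y, differentiable ('D_v f) y) ->
  {for x, continuous ('D_v ('D_u f))} -> {for x, continuous ('D_u ('D_v f))} ->
  'D_u ('D_v f) x = 'D_v ('D_u f) x.
Proof.
move=> df dfu dfv cvu cuv; apply/eqP; rewrite -subr_eq0 -normr_le0.
apply/ler_addgt0Pl => e e0; rewrite addr0.
have tri (a b c : R) : `|a - c| < e / 2 -> `|b - c| < e / 2 -> `|b - a| <= e.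
  rewrite (distrC a) => ac bc.
  rewrite (le_trans (ler_distD c _ _))// (splitr e).
  by rewrite lerD// ltW.
have e2 : 0 < e / 2 by rewrite divr_gt0.
have close (g : V -> R) : {for x, continuous g} ->
    \forall y \near x, `|g x - g y| < e / 2.
  by move=> cg; apply: cvgr_dist_lt.
have close2 := filterI (close _ cvu) (close _ cuv).
have /nbhs_normP[r /= r0 Hr] : \forall y \near x,
    `|'D_v ('D_u f) x - 'D_v ('D_u f) y| < e / 2 /\
    `|'D_u ('D_v f) x - 'D_u ('D_v f) y| < e / 2.
  exact: close2.
(* Any [h] with [h * (|u| + |v|) < r] keeps all mean-value points in the ball; the [+ 1] covers
   [u = v = 0]. *)
pose h := r / (`|u| + `|v| + 1).
have D0 : 0 < `|u| + `|v| + 1 by rewrite ltr_wpDl// addr_ge0.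
have h0 : 0 < h by rewrite divr_gt0.
have near_x (c c' : R) : 0 <= c <= h -> 0 <= c' <= h ->
    `|x - (x + c *: u + c' *: v)| < r.
  move=> /andP[c0 ch] /andP[c'0 c'h].
  rewrite -addrA opprD addNKr normrN (le_lt_trans (ler_normD _ _))// !normrZ.
  rewrite !ger0_norm// (@le_lt_trans _ _ (h * (`|u| + `|v|)))//.
    by rewrite mulrDr lerD// ler_wpM2r.
  rewrite -[ltRHS](divfK (lt0r_neq0 D0)) -/h ltr_pM2l//; lra.
have [[c1 c2] /= [c1h c2h E]] := second_difference v x df dfu (ltW h0).
have [[d1 d2] /= [d1h d2h E']] := second_difference u x df dfv (ltW h0).
have [A _] := Hr _ (near_x _ _ c1h c2h).
have [|_] := Hr (x + d1 *: v + d2 *: u).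
  by rewrite /ball_ /= (addrAC x); exact: near_x.
(* The second difference is unchanged when [u] and [v] are swapped, so both mixed derivatives equal
   it after division by [h] twice. *)
have -> : 'D_u ('D_v f) (x + d1 *: v + d2 *: u) =
          'D_v ('D_u f) (x + c1 *: u + c2 *: v).
  apply: (mulfI (lt0r_neq0 h0)); apply: (mulfI (lt0r_neq0 h0)).
  rewrite -[LHS]E' -[RHS]E (addrAC x (h *: v)).
  by congr (_ + _); apply: addrAC.
exact: tri A.
Qed.

End DirectionalDerivatives.

(** * Sup norm estimates and perturbation of invertible matrices *)

Section SupNorm.
Variables (R : realType) (n : nat).
Implicit Types (u v w z : 'cV[R]_n.+1) (A B : 'M[R]_n.+1).

Lemma col_norm_ge u i : `|u i 0| <= `|u|.
Proof.
rewrite [leRHS]mx_normrE.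
exact: (@le_bigmax _ _ _ 0 (fun ij : 'I_n.+1 * 'I_1 => `|u ij.1 ij.2|) (i, 0)).
Qed.

Lemma col_norm_le u c : (forall i, `|u i 0| <= c) -> `|u| <= c.
Proof.
move=> uc; rewrite [leLHS]mx_normrE; apply: bigmax_le.
  exact: le_trans (uc ord0).
by move=> [i j] _ /=; rewrite (ord1 j).
Qed.

Lemma norm_sum_le (F : 'I_n.+1 -> R) c :
  (forall i, `|F i| <= c) -> `|\sum_i F i| <= n.+1%:R * c.
Proof.
move=> Fc; apply: le_trans (ler_norm_sum _ _ _) _.
apply: (@le_trans _ _ (\sum_(i < n.+1) c)); first exact: ler_sum.
by rewrite sumr_const card_ord mulr_natl.
Qed.

Lemma norm_mulmx_le A v a :
  (forall i j, `|A i j| <= a) -> `|A *m v| <= n.+1%:R * (a * `|v|).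
Proof.
move=> Aa; apply: col_norm_le => i; rewrite mxE; apply: norm_sum_le => j.
by rewrite normrM ler_pM// col_norm_ge.
Qed.

Lemma dot_ge0 u : 0 <= dot u u.
Proof. by apply: sumr_ge0 => i _; rewrite -expr2 sqr_ge0. Qed.

(** Together with [enorm_le_norm], this lets all estimates be made in the sup norm and moved to the
    Euclidean norm only at the end. *)
Lemma norm_le_enorm u : `|u| <= enorm u.
Proof.
apply: col_norm_le => i; rewrite -sqrtr_sqr ler_sqrt ?dot_ge0//.
rewrite /dot (bigD1 i)//= expr2 lerDl sumr_ge0// => j _.
by rewrite -expr2 sqr_ge0.
Qed.

Lemma enorm_le_norm u : enorm u <= n.+1%:R * `|u|.
Proof.
rewrite -[leRHS]ger0_norm ?mulr_ge0// -sqrtr_sqr ler_sqrt ?sqr_ge0//.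
apply: le_trans (ler_norm _) _.
apply: (@le_trans _ _ (n.+1%:R * `|u| ^+ 2)).
  by apply: norm_sum_le => i; rewrite normrM expr2 ler_pM// col_norm_ge.
by rewrite exprMn ler_wpM2r ?sqr_ge0// expr2 ler_peMl// ler1n.
Qed.

Lemma mx_entries_bounded A : exists2 a : R, 0 < a & forall i j, `|A i j| <= a.
Proof.
exists (`|A| + 1) => [|i j]; first by rewrite ltr_pwDr.
apply: (@le_trans _ _ `|A|); last by rewrite lerDl.
rewrite [leRHS]mx_normrE.
exact: (@le_bigmax _ _ _ 0
  (fun ij : 'I_n.+1 * 'I_n.+1 => `|A ij.1 ij.2|) (i, j)).
Qed.

Lemma unitmx_of_injective A :
  (forall v, A *m v = 0 -> v = 0) -> A \in unitmx.
Proof.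
move=> Ainj; rewrite -unitmx_tr -row_free_unit; apply: inj_row_free => v vA.
apply: trmx_inj; rewrite trmx0; apply: Ainj.
by rewrite -[A]trmxK -trmx_mul vA trmx0.
Qed.

Lemma posdef_unitmx A : posdef A -> A \in unitmx.
Proof.
move=> Apos; apply: unitmx_of_injective => v Av0; apply/eqP/negPn/negP => /Apos.
by rewrite Av0 /dot big1 ?ltxx// => i _; rewrite mxE mulr0.
Qed.

(** In [z = invmx A *m (B *m z + (A - B) *m z)] the smallness condition bounds the contribution of
    the second term by half of [|z|], which the left side absorbs; hence the factor 2. *)
Lemma perturbed_mulmx_norm_ge A B z (a e : R) :
  A \in unitmx -> (forall i j, `|invmx A i j| <= a) ->
  (forall i j, `|(A - B) i j| <= e) ->
  n.+1%:R * a * (n.+1%:R * e) <= 2^-1 ->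
  `|z| <= 2 * (n.+1%:R * a) * `|B *m z|.
Proof.
move=> Au Aa ABe small.
have a0 : 0 <= a by exact: le_trans (Aa ord0 ord0).
set w := B *m z.
have zE : invmx A *m (w + (A - B) *m z) = z.
  by rewrite -mulmxDl addrC subrK mulmxA mulVmx// mul1mx.
have H : `|z| <= n.+1%:R * a * (`|w| + n.+1%:R * e * `|z|).
  rewrite -[in leLHS]zE -mulrA (le_trans (norm_mulmx_le _ Aa))// ler_wpM2l//.
  rewrite ler_wpM2l// (le_trans (ler_normD _ _))// lerD2l -mulrA.
  exact: norm_mulmx_le.
have : n.+1%:R * a * (n.+1%:R * e) * `|z| <= 2^-1 * `|z| by rewrite ler_wpM2r.
move: H; rewrite mulrDr mulrA; lra.
Qed.

End SupNorm.

(** * Quadratic error of the exact Newton step *)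

Section NewtonStep.
Variables (R : realType) (n : nat).
Implicit Types (f g : 'cV[R]_n.+1 -> R) (x y z u v : 'cV[R]_n.+1).

Lemma derive_coord g x v : differentiable g x ->
  'D_v g x = \sum_i v i 0 * 'D_(ebasis R i) g x.
Proof.
move=> dg; rewrite deriveE// {1}[v]matrix_sum_delta linear_sum.
by apply: eq_bigr => i _; rewrite big_ord1 linearZ deriveE.
Qed.

Lemma class_C3_derive f : class_C 3 f ->
  [/\ forall y, differentiable f y,
      forall v y, differentiable ('D_v f) y &
      forall u v y, differentiable (fun y => D2 f y u v) y].
Proof.
move=> [df dDf]; split=> [//|v y|u v y]; first exact: (dDf v).1.
exact: ((dDf v).2 u).1.
Qed.

Lemma D2_symmetric f x u v : class_C 3 f -> D2 f x u v = D2 f x v u.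
Proof.
move=> /class_C3_derive[df dDf dD2f]; apply: derive_symmetric => //.
  exact: differentiable_continuous (dD2f v u x).
exact: differentiable_continuous (dD2f u v x).
Qed.

(** The statement is coordinatewise because the intermediate point [c] depends on [i]. *)
Lemma grad_mean_value f x y i : class_C 3 f ->
  exists2 c : R, 0 <= c <= 1 &
    grad f y i 0 - grad f x i 0 = (hess f (x + c *: (y - x)) *m (y - x)) i 0.
Proof.
move=> f3; have [df dDf _] := class_C3_derive f3.
have [c c01 E] := MVT_line (y - x) x (dDf (ebasis R i)) ler01.
exists c => //; move: E.
rewrite scale1r (addrC x (y - x)) subrK mul1r !mxE => ->.
rewrite derive_coord//; apply: eq_bigr => j _.
(* Differentiating the [i]-th partial derivative produces column [i] of the Hessian, while the
   product reads row [i]. *)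
by rewrite [X in _ = X * _]mxE (D2_symmetric _ _ _ f3) mulrC.
Qed.

Lemma segment_in_ball x y z (c r : R) : `|x - z| <= r -> `|y - z| <= r ->
  0 <= c <= 1 -> `|x + c *: (y - x) - z| <= r.
Proof.
move=> xr yr /andP[c0 c1].
have -> : x + c *: (y - x) - z = (1 - c) *: (x - z) + c *: (y - z).
  rewrite !scalerBr !scalerBl !scale1r.
  by apply/matrixP => i j; rewrite !mxE; ring.
rewrite (le_trans (ler_normD _ _))// !normrZ (ger0_norm c0).
rewrite ger0_norm ?subr_ge0//.
have -> : r = (1 - c) * r + c * r by ring.
by rewrite lerD// ler_wpM2l// subr_ge0.
Qed.

(** Each entry obeys the mean value theorem on the segment, which stays in the ball by convexity, so
    the bound on third derivatives applies there. *)
Lemma hess_lipschitz f z (r M : R) : class_C 3 f ->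
  (forall y, `|y - z| <= r -> forall i j l,
     `|D3 f y (ebasis R i) (ebasis R j) (ebasis R l)| <= M) ->
  forall x y, `|x - z| <= r -> `|y - z| <= r ->
  forall i j, `|(hess f y - hess f x) i j| <= n.+1%:R * (M * `|y - x|).
Proof.
move=> f3 D3M x y xr yr i j; have [_ _ dD2f] := class_C3_derive f3.
have [c c01 E] := MVT_line (y - x) x (dD2f (ebasis R i) (ebasis R j)) ler01.
move: E; rewrite scale1r (addrC x (y - x)) subrK mul1r !mxE => ->.
rewrite derive_coord//; apply: norm_sum_le => l.
rewrite normrM mulrC ler_pM//; last exact: col_norm_ge.
exact: D3M (segment_in_ball xr yr c01) l i j.
Qed.

Lemma newton_step_quadratic f z (r M : R) : class_C 3 f ->
  grad f z = 0 -> hess f z \in unitmx -> 0 < r ->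
  (forall y, `|y - z| <= r -> forall i j l,
     `|D3 f y (ebasis R i) (ebasis R j) (ebasis R l)| <= M) ->
  exists K delta : R, [/\ 0 <= K, 0 < delta & forall x, `|x - z| <= delta ->
    `|x + newton f x - z| <= K * `|x - z| ^+ 2].
Proof.
move=> f3 gz Hu r0 D3M.
have lip := hess_lipschitz f3 D3M.
have zr : `|z - z| <= r by rewrite subrr normr0 ltW.
have M0 : 0 <= M by exact: le_trans (D3M _ zr ord0 ord0 ord0).
have [a a0 Ha] := mx_entries_bounded (invmx (hess f z)).
set N : R := n.+1%:R in lip *.
have N0 : 0 < N by rewrite ltr0n.
pose b := N * a * (N * (N * M)).
have b0 : 0 <= b by rewrite !mulr_ge0// ltW.
(* The first witness is the bound [2 * (N * a)] on the inverse Hessian near [z] times the Taylor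
   remainder constant. The radius [(2 * b + 1)^-1] ensures [b * |x - z| <= 1/2], the smallness
   needed for perturbing [hess f z] into [hess f x]. *)
exists (2 * (N * a) * (N * (N * M))), (Num.min r (2 * b + 1)^-1).
split=> [||x].
- by rewrite !mulr_ge0// ltW.
- by rewrite lt_min r0 invr_gt0 ltr_wpDl// mulr_ge0.
rewrite le_min => /andP[xr xb].
have small : N * a * (N * (N * (M * `|z - x|))) <= 2^-1.
  have -> : N * a * (N * (N * (M * `|z - x|))) = b * `|x - z|.
    by rewrite distrC /b; ring.
  apply: le_trans (ler_wpM2l b0 xb) _.
  rewrite ler_pdivrMr ?ltr_wpDl ?mulr_ge0//; lra.
have ge w := @perturbed_mulmx_norm_ge _ _ _ _ w _ _ Hu Ha (lip _ _ xr zr) small.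
have Hxu : hess f x \in unitmx.
  apply: unitmx_of_injective => w Hw0; apply/eqP; rewrite -normr_le0.
  by rewrite (le_trans (ge w))// Hw0 normr0 mulr0.
rewrite -mulrA; apply: le_trans (ge _) _.
rewrite ler_wpM2l ?mulr_ge0 ?(ltW a0) ?(ltW N0)//.
(* Multiplying the error by the Hessian removes the inverse and leaves the Taylor remainder. *)
have -> : hess f x *m (x + newton f x - z) = hess f x *m (x - z) - grad f x.
  by rewrite addrAC mulmxDr /newton mulmxN mulKVmx.
apply: col_norm_le => i.
have [c c01] := grad_mean_value z x i f3.
rewrite gz [X in _ - X]mxE subr0 => gE.
(* As [grad f z = 0], the gradient coordinate is a Hessian row at an intermediate point applied to
   [x - z]; what remains is a Hessian difference, ready for the Lipschitz bound. *)
have -> : (hess f x *m (x - z) - grad f x) i 0 =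
    ((hess f x - hess f (z + c *: (x - z))) *m (x - z)) i 0.
  rewrite mulmxBl [LHS]mxE [(- grad f x) i 0]mxE gE.
  by rewrite [RHS]mxE [X in _ = _ + X]mxE.
apply: le_trans (col_norm_ge _ _) _.
have yr := segment_in_ball zr xr c01.
apply: le_trans (norm_mulmx_le _ (lip _ _ yr xr)) _.
have -> : x - (z + c *: (x - z)) = (1 - c) *: (x - z).
  by rewrite opprD addrA scalerBl scale1r.
move: c01 => /andP[c0 c1].
rewrite normrZ ger0_norm ?subr_ge0// -/N -!mulrA !ler_wpM2l ?(ltW N0)//.
by rewrite expr2 mulrA ler_wpM2r// ler_piMl// lerBlDr lerDl.
Qed.

End NewtonStep.

(** * From the Newton step to the line-search iteration *)

Lemma nbhs_closed_ball_sub (R : realType) (n : nat) (z : 'cV[R]_n.+1)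
    (U : set 'cV[R]_n.+1) :
  nbhs z U -> exists2 r : R, 0 < r & forall y, `|y - z| <= r -> U y.
Proof.
move=> /nbhs_normP[r /= r0 rU]; exists (r / 2); first by rewrite divr_gt0.
move=> y yr; apply: rU; rewrite /ball_ /= distrC.
by rewrite (le_lt_trans yr)// ltr_pdivrMr// ltr_pMr// ltr1n.
Qed.

(* No convergence of the iterates is assumed: when the current error exceeds
   delta, it is itself at most its square divided by delta. *)
Lemma damped_newton_step (R : realType) (n : nat)
    (e p D : 'cV[R]_n.+1) (al Ca C1 C2 K delta r : R) :
  0 < delta -> 0 <= K -> 0 <= C1 ->
  (`|e| <= delta -> `|e + p| <= K * `|e| ^+ 2) ->
  `|e| <= r -> `|p| <= C1 * r -> `|D| <= C2 * r ^+ 2 ->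
  `|al - 1| <= Ca * r -> `|al| <= 2 ->
  `|e + al *: (p + D)|
    <= (K + `|Ca| * C1 + 2 * `|C2| + (1 + 2 * C1) / delta) * r ^+ 2.
Proof.
move=> d0 K0 C10 quad er pr Dr alr al2.
(* Here [r] is only an upper bound of the sup norm of [e]; it will be the Euclidean error. *)
have r0 : 0 <= r by exact: le_trans er.
have Dr' : `|al *: D| <= 2 * `|C2| * r ^+ 2.
  rewrite normrZ -mulrA ler_pM// (le_trans Dr)// ler_wpM2r ?sqr_ge0//.
  exact: ler_norm.
have A0 : 0 <= `|Ca| * C1 * r ^+ 2 by rewrite !mulr_ge0// sqr_ge0.
have B0 : 0 <= (1 + 2 * C1) / delta * r ^+ 2.
  by rewrite mulr_ge0 ?sqr_ge0// divr_ge0 ?(ltW d0)// addr_ge0// mulr_ge0.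
have K2 : 0 <= K * r ^+ 2 by rewrite mulr_ge0 ?sqr_ge0.
rewrite !mulrDl; case: (leP `|e| delta) => ed.
- have -> : e + al *: (p + D) = e + p + (al - 1) *: p + al *: D.
    by rewrite scalerDr scalerBl scale1r -(addrA e p) subrKC addrA.
  have ep : `|e + p| <= K * r ^+ 2.
    by rewrite (le_trans (quad ed))// ler_wpM2l// lerXn2r// nnegrE.
  have alp : `|(al - 1) *: p| <= `|Ca| * C1 * r ^+ 2.
    rewrite normrZ expr2 mulrACA ler_pM// (le_trans alr)// ler_wpM2r//.
    exact: ler_norm.
  have := ler_normD (e + p + (al - 1) *: p) (al *: D).
  have := ler_normD (e + p) ((al - 1) *: p); lra.
- have dr : delta < r by exact: lt_le_trans er.
  have alp : `|al *: p| <= 2 * C1 * r by rewrite normrZ -mulrA ler_pM.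
  (* Far from the minimizer the linear bound on [e + al *: p] becomes quadratic through
     [delta < r]. *)
  have rr : (1 + 2 * C1) * r <= (1 + 2 * C1) / delta * r ^+ 2.
    rewrite -mulrA ler_wpM2l ?addr_ge0 ?mulr_ge0// ler_pdivlMl// expr2.
    by rewrite ler_wpM2r// ltW.
  rewrite scalerDr addrA.
  have := ler_normD (e + al *: p) (al *: D); have := ler_normD e (al *: p).
  move: rr; rewrite !mulrDl mul1r; lra.
Qed.

Theorem theorem7p16 (R : realType) (n : nat) (f : 'cV[R]_n.+1 -> R)
    (xstar : 'cV[R]_n.+1) (U : set 'cV[R]_n.+1)
    (x d Delta : nat -> 'cV[R]_n.+1) (alpha : nat -> R) (Calpha : R) :
  class_C 3 f ->
  grad f xstar = 0 ->
  posdef (hess f xstar) ->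
  nbhs xstar U ->
  (forall y, U y -> exists v, is_affine_normal f xstar y v) ->
  (exists M : R, forall y, U y -> forall i j l : 'I_n.+1,
     `|D3 f y (ebasis R i) (ebasis R j) (ebasis R l)| <= M) ->
  (forall k, is_affine_normal_descent f xstar (x k) (d k)) ->
  (forall k, d k = newton f (x k) + Delta k) ->
  (exists C : R, \forall k \near \oo,
     enorm (newton f (x k)) <= C * enorm (x k - xstar)) ->
  (exists C : R, \forall k \near \oo,
     enorm (Delta k) <= C * enorm (x k - xstar) ^+ 2) ->
  (forall k, x k.+1 = x k + alpha k *: d k) ->
  alpha k @[k --> \oo] --> (1 : R) ->
  (\forall k \near \oo, `|alpha k - 1| <= Calpha * enorm (x k - xstar)) ->
  exists C : R, 0 < C /\ \forall k \near \oo,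
    enorm (x k.+1 - xstar) <= C * enorm (x k - xstar) ^+ 2.
Proof.
move=> f3 gz Hpos nU _ [M D3M] _ dE [C1 HN] [C2 HD] xE al1 Hal.
have [r r0 rU] := nbhs_closed_ball_sub nU.
have [K [delta [K0 d0 quad]]] := newton_step_quadratic f3 gz
  (posdef_unitmx Hpos) r0 (fun y yr => D3M y (rU y yr)).
(* Absolute values appear because the given constants carry no sign. *)
pose C := K + `|Calpha| * `|C1| + 2 * `|C2| + (1 + 2 * `|C1|) / delta.
have C0 : 0 <= C.
  by rewrite !addr_ge0 ?mulr_ge0 ?invr_ge0 ?(ltW d0)// addr_ge0// mulr_ge0.
(* The factor [n.+1] pays for the return to the Euclidean norm; [+ 1] makes the constant strictly
   positive. *)
exists (n.+1%:R * (C + 1)); split; first by rewrite mulr_gt0// ltr_wpDl.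
(* Tolerance 1 suffices: it yields [|alpha k| <= 2]. *)
have Hal2 : \forall k \near \oo, `|1 - alpha k| < 1.
  by move: al1 => /cvgrPdist_lt; apply.
apply: filterS (filterI (filterI HN HD) (filterI Hal Hal2)) => k.
move=> [[hN hD] [hal hal2]].
have e0 : 0 <= enorm (x k - xstar) by exact: sqrtr_ge0.
apply: le_trans (enorm_le_norm _) _; rewrite -mulrA ler_wpM2l//.
apply: (@le_trans _ _ (C * enorm (x k - xstar) ^+ 2)); last first.
  by rewrite ler_wpM2r ?sqr_ge0// lerDl.
rewrite xE dE addrAC.
apply: (damped_newton_step d0 K0 (normr_ge0 C1) _ (norm_le_enorm _) _ _ hal).
- by move=> /quad; rewrite addrAC.
- rewrite (le_trans (norm_le_enorm _))// (le_trans hN)// ler_wpM2r//.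
  exact: ler_norm.
- exact: le_trans (norm_le_enorm _) hD.
- by have := ler_normD (alpha k - 1) 1; rewrite subrK normr1 distrC; lra.
Qed.
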